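(* Let $\mathfrak g$ be a finite-dimensional semisimple complex Lie algebra and let $\theta\in\operatorname{Int}(\mathfrak g)$ be an inner automorphism of order $m$, classified by labels $\{p_j\}$ on the affine Dynkin diagram of $\mathfrak g$. If there exists an automorphism of the diagram that maps a nonzero label $p_j>0$ to the lowest root $\alpha_0$, then the $\mathbb Z/m\mathbb Z$-grading of $\mathfrak g$ given by $\theta$ lifts to a $\mathbb Z$-grading of the form $$\mathfrak g=\mathfrak g_{1-m}\oplus\dots\oplus\mathfrak g_0\oplus\dots\oplus\mathfrak g_{m-1}.$$
   Context: **Gradings.** Let $\zeta_m=\exp(2\pi i/m)$. An order $m$ automorphism $\theta$ of $\mathfrak g$ gives the $\mathbb Z/m\mathbb Z$-grading $\mathfrak g=\bigoplus_{j\in\mathbb Z/m\mathbb Z}\bar{\mathfrak g}_j$ with $\bar{\mathfrak g}_j=\{x:\theta(x)=\zeta_m^jx\}$. A $\mathbb Z$-grading is a decomposition $\mathfrak g=\bigoplus_{j\in\mathbb Z}\mathfrak g_j$ with $[\mathfrak g_j,\mathfrak g_k]\subseteq\mathfrak g_{j+k}$. The $\mathbb Z/m\mathbb Z$-grading lifts to the $\mathbb Z$-grading if $\bar{\mathfrak g}_j=\bigoplus_{k\equiv j\bmod m}\mathfrak g_k$ for all $j$. The displayed form means that $\mathfrak g_j=0$ for $|j|\ge m$ (so $\bar{\mathfrak g}_0=\mathfrak g_0$). **Classification of inner automorphisms by labels.** For $\theta\in\operatorname{Int}(\mathfrak g)$ of order $m$ there are a Cartan subalgebra $\mathfrak t\subseteq\mathfrak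 g$, simple roots $\alpha_1,\dots,\alpha_r$ of $(\mathfrak g,\mathfrak t)$, with highest root $\delta=\sum_{k=1}^rn_k\alpha_k$, lowest root $\alpha_0=-\delta$ and $n_0=1$, and integers $p_0,\dots,p_r\ge0$ (labels on the vertices $\alpha_0,\dots,\alpha_r$ of the affine Dynkin diagram), such that $\sum_{k=0}^rn_kp_k=m$ and each root space $\mathfrak g_\alpha$ lies in the piece $\bar{\mathfrak g}_{\bar p_\alpha}$, where $\bar p_\alpha=\sum_{k=0}^rn_k^\alpha p_k\bmod m$ for $\alpha=\sum_{k=0}^rn_k^\alpha\alpha_k$ written in the unique coordinates with $0\le n_k^\alpha\le n_k$. An automorphism of the affine Dynkin diagram permutes its vertices and hence the labels $p_j$; the hypothesis is that some automorphism carries a vertex with label $p_j>0$ to the vertex $\alpha_0$. *)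

(* Defs.v *)
From HB Require Import structures.
From mathcomp Require Import all_boot all_order all_fingroup all_algebra.
From mathcomp Require Import complex.
From mathcomp Require Import reals trigo.

Set Implicit Arguments.
Unset Strict Implicit.
Unset Printing Implicit Defensive.

Import Order.TTheory GRing.Theory Num.Theory.
Local Open Scope ring_scope.
Local Open Scope complex_scope.

HB.mixin Record Vector_isLie (K : fieldType) L of Vector K L := {
  lie : L -> L -> L;
  lie_linearl : forall y, linear (lie^~ y);
  lie_linearr : forall x, linear (lie x);
  liexx : forall x, lie x x = 0;
  lie_jacobi : forall x y z,
    lie x (lie y z) + lie y (lie z x) + lie z (lie x y) = 0
}.

#[short(type="lieAlgType")]
HB.structure Definition LieAlgebra (K : fieldType) :=
  {L of Vector_isLie K L & Vector K L}.

Section LieAlgebraTheory.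
Variables (K : fieldType) (g : lieAlgType K).
Implicit Types (U V I t : {vspace g}) (x y : g) (f : 'End(g)).

(* By bilinearity, brackets of basis vectors span [U, V]. *)
Definition lie_span U V : {vspace g} :=
  <<[seq lie x y | x <- vbasis U, y <- vbasis V]>>%VS.

Definition is_ideal I := forall x y, y \in I -> lie x y \in I.

Definition is_solvable I := exists n, iter n (fun U => lie_span U U) I = 0%VS.

Definition is_semisimple := forall I, is_ideal I -> is_solvable I -> I = 0%VS.

Definition ad_diagonalizable x :=
  exists2 b : seq g, basis_of fullv b
    & forall v, v \in b -> exists c : K, lie x v = c *: v.

(* Cartan subalgebra of a complex semisimple Lie algebra, as in B. C. Hall,
   "Lie Groups, Lie Algebras, and Representations", Definition 7.10. *)
Definition is_cartan t := [/\
  forall h h', h \in t -> h' \in t -> lie h h' = 0,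
  forall x, (forall h, h \in t -> lie h x = 0) -> x \in t &
  forall h, h \in t -> ad_diagonalizable h].

Definition dual t : vectType K := 'Hom(subvs_of t, K^o).

Definition in_root_space t (a : dual t) x :=
  forall h : subvs_of t, lie (vsval h) x = (a h : K) *: x.

Definition is_root t (a : dual t) :=
  a != 0 /\ exists2 x, x != 0 & in_root_space a x.

(* Simple roots: a linearly independent family of roots such that every root is
   a combination of them with integer coefficients all of the same sign. *)
Definition is_base t (r : nat) (b : 'I_r -> dual t) := [/\
  forall k, is_root (b k),
  free [seq b k | k : 'I_r] &
  forall a, is_root a -> exists c : 'I_r -> nat,
    a = \sum_k b k *+ c k \/ a = - \sum_k b k *+ c k].

(* delta dominates every root, which can only happen for irreducible root
   systems. *)
Definition is_highest_root t (r : nat) (b : 'I_r -> dual t) (delta : dual t) :=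
  is_root delta /\
  forall a, is_root a -> exists c : 'I_r -> nat, delta - a = \sum_k b k *+ c k.

(* Vertices of the affine Dynkin diagram: alpha ord0 is the lowest root,
   alpha (lift ord0 k) for k < r are the simple roots. *)
Definition affine_system t (r : nat) (alpha : 'I_r.+1 -> dual t)
    (n : 'I_r.+1 -> nat) :=
  let simple k := alpha (lift ord0 k) in
  let delta := \sum_(k < r) simple k *+ n (lift ord0 k) in
  [/\ is_base simple, is_highest_root simple delta,
      alpha ord0 = - delta & n ord0 = 1%N].

(* h is the middle element of an sl2-triple (x, h, y) with x in the root space
   of a and y in that of -a. *)
Definition is_coroot t (a : dual t) (h : subvs_of t) :=
  a h = 2 /\ exists x y, [/\ in_root_space a x, in_root_space (- a) y
                           & vsval h = lie x y].

(* c = <a, b^vee> *)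
Definition is_cartan_integer t (a b : dual t) (c : K) :=
  exists2 h, is_coroot b h & a h = c.

(* The (multi-)edges and arrows of the affine Dynkin diagram encode exactly the
   Cartan integers of its vertices. *)
Definition diagram_automorphism t (r : nat) (alpha : 'I_r.+1 -> dual t)
    (s : {perm 'I_r.+1}) :=
  forall i j c, is_cartan_integer (alpha (s i)) (alpha (s j)) c <->
                is_cartan_integer (alpha i) (alpha j) c.

Definition is_lie_automorphism f :=
  lker f = 0%VS /\ forall x y, f (lie x y) = lie (f x) (f y).

Definition has_order f (m : nat) := [/\ (0 < m)%N,
  forall x, iter m f x = x &
  forall k, (0 < k < m)%N -> exists x, iter k f x != x].

(* V is the internal direct sum of the G j for j in P: every finite subfamily
   is independent, and V is the set of all finite sums. *)
Definition direct_sum_over (P : pred int) (G : int -> {vspace g}) V :=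
  (forall s : seq int, uniq s -> all P s -> directv (\sum_(j <- s) G j)%VS) /\
  (forall x, x \in V <->
     exists2 s : seq int, all P s & x \in (\sum_(j <- s) G j)%VS).

Definition is_Zgrading (G : int -> {vspace g}) :=
  direct_sum_over predT G fullv /\
  forall j k x y, x \in G j -> y \in G k -> lie x y \in G (j + k).

End LieAlgebraTheory.

Section ComplexLieAlgebra.
Variables (R : realType) (g : lieAlgType R[i]).
Implicit Types (t : {vspace g}) (x y : g) (f : 'End(g)).

(* f = exp (ad x); a sequence of vectors converges iff its coordinates do. *)
Definition is_exp_ad x f := forall y (i : 'I_(\dim {:g})) (e : R[i]), 0 < e ->
  exists N : nat, forall n, (N <= n)%N ->
    `|coord (vbasis {:g}) i (\sum_(k < n) (k`!%:R)^-1 *: iter k (lie x) y - f y)|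
      < e.

(* The inverse of exp (ad x) is exp (ad (- x)), so the products of such maps
   form the group that they generate. *)
Inductive Int_generated : 'End(g) -> Prop :=
| Int_one : Int_generated \1%VF
| Int_mul x e f : is_exp_ad x e -> Int_generated f -> Int_generated (e \o f)%VF.

Definition inner_automorphism f := is_lie_automorphism f /\ Int_generated f.

Definition zeta (m : nat) : R[i] :=
  cos (2 * pi / m%:R) +i* sin (2 * pi / m%:R).

(* The degree j is an integer taken modulo m, as zeta m ^+ m = 1. *)
Definition mod_piece f (m : nat) (j : int) : {vspace g} :=
  passmx.leigenspace f (zeta m ^ j).

(* The coordinates c of a root a with c k <= n k are unique: c ord0 is 0
   when a is positive and 1 when a is negative. *)
Definition classified_by t f (m r : nat) (alpha : 'I_r.+1 -> dual t)
    (n p : 'I_r.+1 -> nat) :=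
  (\sum_k n k * p k = m)%N /\
  forall (a : dual t) (c : 'I_r.+1 -> nat),
    is_root a -> (forall k, c k <= n k)%N -> a = \sum_k alpha k *+ c k ->
    forall x, in_root_space a x ->
      x \in mod_piece f m (\sum_k c k * p k)%N%:Z.

Definition lifts_to f (m : nat) (G : int -> {vspace g}) :=
  forall j : int, direct_sum_over (fun k => (k == j %[mod m%:Z])%Z) G
                    (mod_piece f m j).

End ComplexLieAlgebra.

(* Main.v *)
From HB Require Import structures.
Require Import Defs.
From mathcomp Require Import all_boot all_order all_fingroup all_algebra.
From mathcomp Require Import complex.
From mathcomp Require Import boolp reals trigo.

(* An automorphism of the affine diagram preserves the marks n, which are
   determined up to a scalar by the relation sum_k n k alpha k = 0; hence a vertex
   j that it carries to alpha_0 has mark 1.  Choose h in t with alpha k h = p k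
   for k <> j and alpha j h = p j - m, which the relation allows because
   sum_k n k p k = m and n j = 1.  The eigenspaces of ad h form the Z-grading: a
   root with affine coordinates 0 <= c k <= n k has degree
   sum_k c k p k - c j m with c j in {0, 1}, and p j > 0 keeps it strictly
   between -m and m.

   Root coordinates, coroots and the preservation of the marks rest on the
   nondegeneracy of the Killing form.  Instead of Cartan's criterion, its radical
   is shown to be an ideal meeting t trivially, whose center is nonzero by
   Engel's theorem, contradicting semisimplicity. *)

Set Implicit Arguments.
Unset Strict Implicit.
Unset Printing Implicit Defensive.

Import Order.TTheory GRing.Theory Num.Theory.
Local Open Scope ring_scope.

(** * Linear algebra and Engel's theorem *)

Lemma free_familyP (K : fieldType) (V : vectType K) (r : nat) (b : 'I_r -> V) :
  reflect (forall c : 'I_r -> K, \sum_k c k *: b k = 0 -> forall k, c k = 0)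
          (free [seq b k | k : 'I_r]).
Proof.
have sumE (c : 'I_r -> K) : \sum_k c k *: (mktuple b)`_k = \sum_k c k *: b k.
  by apply: eq_bigr => k _; rewrite -tnth_nth tnth_mktuple.
have -> : free [seq b k | k : 'I_r] = free (mktuple b) by rewrite /image_mem.

by apply: (iffP freeP) => H c; have := H c; rewrite sumE.
Qed.

(** The matrix [A] of values on a basis has independent rows, so its transpose has every row [q] in
    its row space, and the coefficients give [v]. *)
Lemma free_functionals_onto (K : fieldType) (V : vectType K) (r : nat)
    (b : 'I_r -> 'Hom(V, K^o)) (q : 'I_r -> K) :
  free [seq b k | k : 'I_r] -> exists v, forall k, b k v = q k.
Proof.
move=> /free_familyP bfree; pose X := vbasis {:V}.
pose A := \matrix_(k < r, i < \dim {:V}) (b k X`_i : K).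
have Afree : row_free A.
  apply/row_freeP/row_freeP; rewrite -kermx_eq0; apply/eqP/row_matrixP => i.
  rewrite row0; set u := row i _.
  have : u *m A = 0 by apply/sub_kermxP; exact: row_sub.
  move=> uA; apply/rowP => k; rewrite [RHS]mxE; apply: bfree (fun k => u 0 k) _ k.
  apply/lfunP => v; rewrite sum_lfunE zero_lfunE.
  rewrite (coord_vbasis (memvf v)).
  under eq_bigr => k _ do rewrite scale_lfunE linear_sum /= scaler_sumr.
  rewrite exchange_big big1 //= => j _.
  under eq_bigr => k _ do rewrite linearZ /= scalerA mulrC -scalerA.
  rewrite -scaler_sumr; transitivity (coord X j v *: ((u *m A) 0 j : K^o)).
    rewrite [(u *m A) 0 j]mxE; congr (_ *: _).
    by apply: eq_bigr => k _; rewrite [A k j]mxE.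
  by rewrite uA mxE scaler0.
have Afull : row_full A^T by rewrite /row_full mxrank_tr.
have /submxP[u qE] : (\row_k q k <= A^T)%MS by apply: submx_full.
exists (\sum_i u 0 i *: X`_i) => k.
have /rowP/(_ k) := qE; rewrite !mxE => ->; rewrite linear_sum /=.
by apply: eq_bigr => i _; rewrite linearZ /= !mxE.
Qed.

Lemma iter_linear_comb (K : fieldType) (V : vectType K) (f : {linear V -> V})
    (n : nat) (c : 'I_n -> K) (v : 'I_n -> V) (m : nat) :
  iter m f (\sum_i c i *: v i) = \sum_i c i *: iter m f (v i).
Proof.
elim: m => //= m ->; rewrite linear_sum.
by apply: eq_bigr => i _; rewrite linearZ.
Qed.

Section LieTheory.
Variables (K : fieldType) (g : lieAlgType K).
Implicit Types (x y z : g) (t U : {vspace g}).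

HB.instance Definition _ x := GRing.isSemilinear.Build K g g _ (lie x)
  (GRing.semilinear_linear (lie_linearr x)).

Lemma lieC x y : lie x y = - lie y x.
Proof.
apply/eqP; rewrite -addr_eq0; apply/eqP.
have := liexx (x + y).
have lD a b c : lie (a + b) c = lie a c + lie b c.
  by have := lie_linearl c 1 a b; rewrite /= !scale1r.
by rewrite lD !linearD /= !liexx add0r addr0.
Qed.

Lemma lieDl y : {morph lie^~ y : x z / x + z}.
Proof. by move=> x z /=; rewrite !(lieC _ y) linearD opprD. Qed.

Lemma lieZl (c : K) x y : lie (c *: x) y = c *: lie x y.
Proof. by rewrite !(lieC _ y) linearZ scalerN. Qed.

Lemma lie0l y : lie 0 y = 0.
Proof. by rewrite lieC linear0 oppr0. Qed.

Lemma lieNl x y : lie (- x) y = - lie x y.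
Proof. by rewrite -scaleN1r lieZl scaleN1r. Qed.

Lemma lie_suml (I : Type) (s : seq I) (P : pred I) (F : I -> g) y :
  lie (\sum_(i <- s | P i) F i) y = \sum_(i <- s | P i) lie (F i) y.
Proof. exact: (big_morph _ (lieDl y) (lie0l y)). Qed.

Lemma lie_lie x y z : lie x (lie y z) = lie (lie x y) z + lie y (lie x z).
Proof.
have := lie_jacobi x y z; rewrite (lieC z (lie x y)) (lieC z x) linearN /=.
by move/eqP; rewrite subr_eq0 => /eqP <-; rewrite addrNK.
Qed.

Lemma lieKl x y z : lie (lie x y) z = lie x (lie y z) - lie y (lie x z).
Proof. by rewrite lie_lie addrK. Qed.

Lemma lie_span_eq0 U :
  {in U &, forall x y, lie x y = 0} -> lie_span U U = 0%VS.
Proof.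
move=> abU; apply/eqP; rewrite -subv0.
apply/span_subvP => _ /allpairsP[[x y] /= [xU yU ->]].
by rewrite abU ?mem0v // (vbasis_mem xU, vbasis_mem yU).
Qed.

Lemma abelian_ideal_eq0 U : is_semisimple g -> is_ideal U ->
  {in U &, forall x y, lie x y = 0} -> U = 0%VS.
Proof. by move=> ss idU abU; apply: ss => //; exists 1%N; apply: lie_span_eq0. Qed.

(** The line through a central element is an abelian ideal. *)
Lemma central_eq0 x : is_semisimple g -> (forall y, lie x y = 0) -> x = 0.
Proof.
move=> ss cx; apply/eqP; rewrite -memv0.
have <- : <[x]>%VS = 0%VS; last exact: memv_line.
apply: abelian_ideal_eq0 => // [y _ /vlineP[c ->]|_ _ /vlineP[c ->] /vlineP[d ->]].
  by rewrite linearZ /= lieC cx oppr0 scaler0 mem0v.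
by rewrite lieZl cx scaler0.
Qed.

Lemma in_root_space_lie t (a b : dual t) x y :
  in_root_space a x -> in_root_space b y -> in_root_space (a + b) (lie x y).
Proof.
move=> ax by_ h; rewrite lie_lie ax by_ linearZ lieZl /= -scalerDl.
by rewrite add_lfunE.
Qed.

Lemma in_root_spaceZ t (a : dual t) c x :
  in_root_space a x -> in_root_space a (c *: x).
Proof. by move=> ax h; rewrite linearZ /= ax !scalerA mulrC. Qed.

Lemma in_root_space0 t (a : dual t) : in_root_space a 0.
Proof. by move=> h; rewrite linear0 scaler0. Qed.

Lemma lie_span_in (s : seq g) (W : {vspace g}) v : (forall a, a \in s -> lie v a \in W) ->
  forall y, y \in <<s>>%VS -> lie v y \in W.
Proof.
move=> sW y; rewrite -(lfunE (lie v)) memv_preim; apply/subvP/span_subvP => a as_.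
by rewrite -memv_preim lfunE sW.
Qed.

(* Jacobson's form of Engel's theorem, for a bracket-closed set S of
   ad-nilpotent elements: the property carried along is that, for every pair
   [W, V] stable under a finite part s of S, some vector of V outside W is sent
   into W. *)
Definition engel_property (s : seq g) :=
  forall (V : g -> Prop) (W : {vspace g}),
    (forall a v, a \in s -> V v -> V (lie a v)) ->
    (forall a v, a \in s -> v \in W -> lie a v \in W) ->
    (exists2 v, V v & v \notin W) ->
    exists v, [/\ V v, v \notin W & forall a, a \in s -> lie a v \in W].

(** The vectors of [V] that [s] sends into [W] are stable under [lie x], because [lie a x] stays in
    the span of [s]. By nilpotency, the last iterate outside [W] is sent into [W] by [x] as well. *)
Lemma engel_property_cons s x :
  (forall a, a \in s -> lie a x \in <<s>>%VS) ->
  (forall v, exists k, iter k (lie x) v = 0) ->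
  engel_property s -> engel_property (x :: s).
Proof.
move=> sx nilx Es V W sV sW VW.
have [||v [Vv vW avW]] := Es V W _ _ VW.
- by move=> a v as_; apply: sV; rewrite inE as_ orbT.
- by move=> a v as_; apply: sW; rewrite inE as_ orbT.
have [k iterk] := nilx v.
pose good v := V v /\ forall a, a \in s -> lie a v \in W.
have good_span u y : good u -> y \in <<s>>%VS -> lie y u \in W.
  move=> [_ gu] ys; rewrite lieC rpredN; apply: lie_span_in ys => a as_.
  by rewrite lieC rpredN gu.
have good_lie u : good u -> good (lie x u).
  move=> gu; split=> [|a as_]; first by apply: sV; [rewrite mem_head|case: gu].
  rewrite lie_lie memvD //; first exact: (good_span _ _ gu (sx a as_)).
  by apply: sW; [rewrite mem_head|case: gu => _; apply].
suff {v Vv vW avW iterk} H : forall k v, good v -> v \notin W -> iter k (lie x) v = 0 ->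
    exists v, [/\ V v, v \notin W & forall a, a \in x :: s -> lie a v \in W].
  by apply: (H k v).
elim=> [|k' IH] v gv vW /=; first by move=> v0; rewrite v0 mem0v in vW.
rewrite -iterS iterSr; case: (boolP (lie x v \in W)) => [xv _|xv itv].
  exists v; split=> //; first by case: gv.
  by move=> a; rewrite inE => /predU1P[->//|]; case: gv => _; apply.
exact: (IH _ (good_lie _ gv) xv itv).
Qed.

(** A finite part [s] of [S] with bracket-closed span is enlarged until it spans [S]; the
    codimension of its span bounds the number of steps. *)
Lemma engel (S : g -> Prop) :
  (forall x y, S x -> S y -> S (lie x y)) ->
  (forall x v, S x -> exists k, iter k (lie x) v = 0) ->
  exists2 s : seq g, engel_property s /\ (forall a, a \in s -> S a)
    & forall x, S x -> x \in <<s>>%VS.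
Proof.
move=> Slie Snil.
suff: forall k (s : seq g), engel_property s -> (forall a, a \in s -> S a) ->
    (forall a b, a \in s -> b \in s -> lie a b \in <<s>>%VS) ->
    (\dim {:g} - \dim <<s>> <= k)%N ->
    exists2 s : seq g, engel_property s /\ (forall a, a \in s -> S a)
      & forall x, S x -> x \in <<s>>%VS.
  move=> /(_ (\dim {:g}) [::]); apply=> //; last exact: leq_subr.
  by move=> V W _ _ [v Vv vW]; exists v.
elim=> [|k IH] s Es sS slie; rewrite ?leqn0 => dims.
  exists s => // x Sx; have : (fullv <= <<s>>)%VS.
    have /leqifP := dimv_leqif_sup (subvf <<s>>).
    by case: ifP => // _; rewrite ltnNge -subn_eq0 dims.
  by move/subvP; apply; apply: memvf.
have [Sin|] := pselect (forall x, S x -> x \in <<s>>%VS); first by exists s.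
move=> /existsNP[x0 /not_implyP[Sx0 /negP x0s]].
(* With [V := S] and [W] the span of [s], the property yields an element of [S] outside the span
   that normalizes it. *)
have [||| x [Sx xs sx]] := Es S <<s>>%VS.
- by move=> a v /sS; apply: Slie.
- by move=> a v as_; apply: lie_span_in => b; apply: slie.
- by exists x0.
have subs : (<<s>> <= <<x :: s>>)%VS.
  by apply: sub_span => y ys; rewrite inE ys orbT.
apply: (IH (x :: s)).
- by apply: engel_property_cons => // v; apply: Snil.
- by move=> a; rewrite inE => /predU1P[->//|/sS].
- move=> a b; rewrite !inE => /predU1P[->|as_] /predU1P[->|bs].
  + by rewrite liexx mem0v.
  + by rewrite lieC rpredN (subvP subs) // sx.
  + by rewrite (subvP subs) // sx.
  + by rewrite (subvP subs) // slie.
- rewrite -ltnS (leq_trans _ dims) // ltn_sub2l //.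
    rewrite ltn_neqAle dimvS ?subvf // andbT; apply: contraNneq xs => dim_eq.
    suff -> : <<s>>%VS = fullv by exact: memvf.
    by apply/eqP; rewrite eqEdim subvf dim_eq /=.
  rewrite ltn_neqAle dimvS // andbT; apply: contraNneq xs => dim_eq.
  suff -> : <<s>>%VS = <<x :: s>>%VS by rewrite memv_span // mem_head.
  by apply/eqP; rewrite eqEdim subs dim_eq /=.
Qed.

End LieTheory.

(** * Weight bases and the Killing form *)

Section WeightBasis.
Import passmx.
Variables (K : fieldType) (g : lieAlgType K) (t : {vspace g}).

Lemma ad_diagonalizable_mx (X : (\dim {:g}).-tuple g) (x : g) :
  basis_of {:g} X -> ad_diagonalizable x ->
  diagonalizable (mxof X X (linfun (lie x))).
Proof.
move=> Xbasis [b bbasis beig].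
have size_b : size b == \dim {:g} by rewrite (size_basis (X := in_tuple b) bbasis).
pose B := Tuple size_b; have Bbasis : basis_of {:g} B by [].
pose P := \matrix_(i < \dim {:g}) rVof X B`_i.
have mulP u : u *m P = rVof X (vecof B u).
  rewrite mulmx_sum_row /vecof linear_sum; apply: eq_bigr => i _.
  by rewrite rowK linearZ.
have Punit : P \in unitmx.
  rewrite -row_free_unit -kermx_eq0; apply/eqP/row_matrixP => i; rewrite row0.
  set u := row i _; have : u *m P = 0 by apply/sub_kermxP; apply: row_sub.
  by rewrite mulP => /eqP; rewrite rVof_eq0 // vecof_eq0 // => /eqP.
have /fin_all_exists[c cE] : forall i : 'I_(\dim {:g}), exists c, lie x B`_i = c *: B`_i.
  by move=> i; apply: beig; rewrite mem_nth // (eqP size_b).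
exists P => //; apply/diagonalizable_forPex; exists (\row_i c i).
apply: simmxW; first by rewrite row_free_unit.
apply/row_matrixP => i; rewrite row_mul rowK mul_mxof rVofK // lfunE /= cE linearZ /=.
by rewrite row_mul row_diag_mx -scalemxAl -rowE mxE rowK.
Qed.

(** The operators [lie h], for [h] in a basis of [t], commute and are diagonalizable, hence have a
    common eigenbasis. *)
Lemma weight_basis : is_cartan t ->
  exists (e : (\dim {:g}).-tuple g) (w : 'I_(\dim {:g}) -> dual t),
    basis_of {:g} e /\ forall i, in_root_space (w i) e`_i.
Proof.
move=> [tab tmax tdiag]; pose X := vbasis {:g}.
have Xbasis : basis_of {:g} X := vbasisP _.
pose A x := mxof X X (linfun (lie x)).
have : codiagonalizable [seq A h | h <- vbasis t].
  apply/codiagonalizableP; split=> [_ _ /mapP[h ht ->] /mapP[k kt ->]|_ /mapP[h ht ->]].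
    rewrite /comm_mx /A -!(mxof_comp _ _ Xbasis); congr mxof; apply/lfunP => y.
    rewrite !comp_lfunE !lfunE /= (lie_lie k).
    rewrite (tab k h) ?(vbasis_mem ht, vbasis_mem kt) //.
    by rewrite lie0l add0r.
  by apply: ad_diagonalizable_mx => //; apply: tdiag; apply: vbasis_mem.
move=> [P Punit /allP Pdiag]; pose e := [tuple vecof X (row i P) | i < \dim {:g}].
have eE (i : 'I_(\dim {:g})) : e`_i = vecof X (row i P) by rewrite -tnth_nth tnth_mktuple.
have ebasis : basis_of {:g} e.
  rewrite basisEfree subvf size_tuple leqnn !andbT; apply/freeP => c c0.
  have : \row_i c i *m P = 0.
    apply: (can_inj (vecofK Xbasis)); rewrite mulmx_sum_row linear_sum linear0 -[RHS]c0.
    apply: eq_bigr => i _.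
    by rewrite linearZ /= mxE eE.
  move=> /(congr1 (mulmx^~ (invmx P))); rewrite mulmxK // mul0mx => /rowP c0' i.
  by have := c0' i; rewrite !mxE.
have eig h (i : 'I_(\dim {:g})) : h \in t -> exists c, lie h e`_i = c *: e`_i.
  move=> ht; rewrite (coord_vbasis ht); set c := fun j => coord (vbasis t) j h.
  have /fin_all_exists[d dE] : forall j : 'I_(\dim t), exists d,
      lie (vbasis t)`_j e`_i = d *: e`_i.
    move=> j; have /Pdiag /diagonalizable_forPex[D DE] :
        A (vbasis t)`_j \in [seq A h | h <- vbasis t].
      by rewrite map_f // mem_nth // size_tuple.
    exists (D 0 i); have /simmxPp : stablemx P (A (vbasis t)`_j).
      by rewrite stablemx_unit.
    move=> /(_ _ DE) /(congr1 (row i)).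
    rewrite !row_mul row_diag_mx -scalemxAl -rowE => PA.
    rewrite -[LHS](lfunE (lie (vbasis t)`_j)) /= eE (hom_vecof _ Xbasis) //.
    by rewrite PA linearZ.
  exists (\sum_j c j * d j); rewrite lie_suml scaler_suml; apply: eq_bigr => j _.
  by rewrite lieZl dE scalerA.
(* Reading the eigenvalue as a coordinate of the bracket makes it visibly linear in [h]. *)
pose f i (h : subvs_of t) : K^o := coord e i (lie (vsval h) e`_i).
have flin i : linear (f i).
  move=> c h k; rewrite /f linearP lieDl lieZl linearD linearZ /=.
  by rewrite [c *: _]/(c * _).
pose fl i : {linear subvs_of t -> K^o} :=
  HB.pack (f i)
   (GRing.isSemilinear.Build _ _ _ _ (f i) (GRing.semilinear_linear (flin i))).
exists e, (fun i => linfun (fl i)); split=> // i h.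
have [c cE] := eig _ i (subvsP h); rewrite lfunE /= /f cE linearZ /=.
by rewrite coord_free ?eqxx ?mulr1 ?(basis_free ebasis).
Qed.
End WeightBasis.

(** * Invariance and orthogonality of the Killing form *)

Section Killing.
Variables (K : fieldType) (g : lieAlgType K) (t : {vspace g}).
Variables (e : (\dim {:g}).-tuple g) (w : 'I_(\dim {:g}) -> dual t).
Hypothesis ebasis : basis_of {:g} e.
Hypothesis eroot : forall i, in_root_space (w i) e`_i.
Implicit Types (x y z : g) (h k : subvs_of t) (a b : dual t).

Lemma coord_expand x : x = \sum_i coord e i x *: e`_i.
Proof. exact: coord_basis ebasis (memvf x). Qed.

Lemma basis_ext x y : (forall i, coord e i x = coord e i y) -> x = y.
Proof.
move=> xy; rewrite (coord_expand x) (coord_expand y).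
by apply: eq_bigr => i _; rewrite xy.
Qed.

Lemma basis_neq0 (i : 'I_(\dim {:g})) : e`_i != 0.
Proof.
by have := basis_not0 ebasis; apply; rewrite mem_nth // size_tuple.
Qed.

Lemma coord_lie_t h x i : coord e i (lie (vsval h) x) = (w i h : K) * coord e i x.
Proof.
rewrite [x in LHS]coord_expand !linear_sum /= (bigD1 i) //= big1 ?addr0 => [|j ji].
  rewrite linearZ /= eroot !linearZ /= coord_free ?(basis_free ebasis) // eqxx.
  by rewrite mulr1 mulrC.
rewrite linearZ /= eroot !linearZ /= coord_free ?(basis_free ebasis) //.
by rewrite (negPf ji) !mulr0.
Qed.

Lemma in_root_spaceP a x :
  in_root_space a x <-> (forall i, coord e i x != 0 -> w i = a).
Proof.
split=> [ax i xi|H h]; last first.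
  apply: basis_ext => i; rewrite coord_lie_t linearZ /=.
  by have [->|/H ->] := eqVneq (coord e i x) 0; rewrite ?mulr0.
apply/lfunP => h; apply: (mulIf xi); rewrite -coord_lie_t ax linearZ //=.
Qed.

Lemma root_weight a : is_root a -> exists i, w i = a.
Proof.
move=> [_ [x x0 /in_root_spaceP H]].
have [i xi] : exists i, coord e i x != 0.
  apply/existsP; rewrite -negb_forall; apply: contraNN x0 => /forallP x0.
  by apply/eqP/basis_ext => i; rewrite linear0; apply/eqP.
by exists i; apply: H.
Qed.

Lemma weight_root i : w i != 0 -> is_root (w i).
Proof. by move=> wi; split=> //; exists e`_i; rewrite ?basis_neq0. Qed.

Lemma cartan_weight0 x : is_cartan t -> in_root_space (0 : dual t) x <-> x \in t.
Proof.
move=> [tab tmax _]; split=> [x0|xt h].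
  apply: tmax => h ht; have := x0 (vsproj t h).
  by rewrite vsprojK // zero_lfunE scale0r.
by rewrite zero_lfunE scale0r tab ?subvsP.
Qed.

(* The Killing form, with the trace computed in the basis of weight vectors. *)
Definition killing x y := \sum_i coord e i (lie x (lie y e`_i)).

(** Commutativity of the trace, from which both the symmetry and the invariance of [killing]
    follow. *)
Lemma trace_comp (f f' : {linear g -> g}) :
  \sum_i coord e i (f (f' e`_i)) = \sum_i coord e i (f' (f e`_i)).
Proof.
have tr (u v : {linear g -> g}) : \sum_(i < \dim {:g}) coord e i (u (v e`_i)) =
    \sum_(i < \dim {:g}) \sum_(j < \dim {:g}) coord e j (v e`_i) * coord e i (u e`_j).
  apply: eq_bigr => i _; rewrite [v _ in LHS]coord_expand !linear_sum /=.
  by apply: eq_bigr => j _; rewrite !linearZ.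
rewrite !tr exchange_big /=; apply: eq_bigr => i _; apply: eq_bigr => j _.
exact: mulrC.
Qed.

Lemma killingC x y : killing x y = killing y x.
Proof. exact: trace_comp. Qed.

Lemma killing_is_linear x : linear (killing x : g -> K^o).
Proof.
move=> c y z; rewrite /killing scaler_sumr -big_split; apply: eq_bigr => i _ /=.
by rewrite lieDl lieZl !linearP.
Qed.
HB.instance Definition _ x := GRing.isSemilinear.Build K g K^o _ (killing x)
  (GRing.semilinear_linear (killing_is_linear x)).

Lemma killingZr c x y : killing x (c *: y) = c * killing x y.
Proof. by rewrite linearZ. Qed.

Lemma killingZl c x y : killing (c *: x) y = c * killing x y.
Proof. by rewrite !(killingC _ y) killingZr. Qed.

Lemma killing0r x : killing x 0 = 0.
Proof. exact: linear0. Qed.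

Lemma killing_basis_eq0 x : (forall i : 'I_(\dim {:g}), killing x e`_i = 0) ->
  forall y, killing x y = 0.
Proof.
move=> x0 y; rewrite (coord_expand y) linear_sum big1 // => i _.
by rewrite linearZ /= x0 scaler0.
Qed.

(** By the Jacobi identity the two sides differ by the trace of the commutator of [lie x \o lie z]
    with [lie y]. *)
Lemma killing_inv x y z : killing (lie x y) z = killing x (lie y z).
Proof.
apply/eqP; rewrite /killing -subr_eq0 -sumrB.
have -> : \sum_i (coord e i (lie (lie x y) (lie z e`_i))
                   - coord e i (lie x (lie (lie y z) e`_i)))
  = \sum_i (coord e i (lie x (lie z (lie y e`_i)))
            - coord e i (lie y (lie x (lie z e`_i)))).
  apply: eq_bigr => i _; rewrite !lieKl !linearB /= opprB addrACA addrC.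
  by rewrite addrA subrK addrC.
by rewrite sumrB subr_eq0 (trace_comp (lie x \o lie z) (lie y)).
Qed.

(** Invariance gives [(a + b) h * killing x y = 0] for every [h], and some [h] makes the first
    factor nonzero. *)
Lemma killing_root_spaces a b x y :
  in_root_space a x -> in_root_space b y -> a + b != 0 -> killing x y = 0.
Proof.
move=> ax by_ /lfunPn[h]; rewrite zero_lfunE add_lfunE => abh; apply: (mulfI abh).
rewrite mulr0 mulrDl -killingZl -killingZr -ax -by_ -killing_inv (lieC x).
by rewrite -[- lie _ _]scaleN1r killingZl mulN1r subrr.
Qed.

Lemma killing_t h k :
  killing (vsval h) (vsval k) = \sum_i (w i h : K) * (w i k : K).
Proof.
apply: eq_bigr => i _; rewrite !coord_lie_t coord_free ?(basis_free ebasis) //.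
by rewrite eqxx mulr1.
Qed.

(** When [y] has weight [- a], this makes [lie x y] the element of [t] representing [a], up to the
    factor [killing x y]. *)
Lemma killing_lie_root a h x y : in_root_space a x ->
  killing (vsval h) (lie x y) = (a h : K) * killing x y.
Proof. by move=> ax; rewrite -killing_inv ax killingZl. Qed.

(** An element of [t] on which all weights vanish is central. *)
Lemma cartan_weights_inj h : is_semisimple g -> (forall i, w i h = 0) -> h = 0.
Proof.
move=> ss wh; apply: val_inj; rewrite linear0; apply: central_eq0 ss _ => y.
by apply: basis_ext => i; rewrite coord_lie_t wh mul0r linear0.
Qed.

End Killing.

(** * Roots and coroots *)

Section Roots.
Variables (C : numClosedFieldType) (g : lieAlgType C) (t : {vspace g}).
Variables (e : (\dim {:g}).-tuple g) (w : 'I_(\dim {:g}) -> dual t).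
Hypothesis ebasis : basis_of {:g} e.
Hypothesis eroot : forall i, in_root_space (w i) e`_i.
Variables (r : nat) (b : 'I_r -> dual t).
Hypothesis ss : is_semisimple g.
Hypothesis cartan_t : is_cartan t.
Hypothesis base_b : is_base b.
Implicit Types (x y z : g) (h k : subvs_of t) (a c : dual t).

Local Notation kappa := (killing e).

Lemma root_combination a : is_root a -> exists c : 'I_r -> int, a = \sum_k b k *~ c k.
Proof.
case: base_b => _ _ H /H[c [->|->]].
  by exists (fun j => (c j)%:Z).
by exists (fun j => - (c j)%:Z); rewrite -sumrN; apply: eq_bigr => k _; rewrite mulrNz.
Qed.

(** Nonzero weights are roots, hence integer combinations of the [b j], so all weights vanish on
    [h - k]. *)
Lemma base_ext h k : (forall j, b j h = b j k) -> h = k.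
Proof.
move=> hk; apply/eqP; rewrite -subr_eq0; apply/eqP.
apply: (cartan_weights_inj ebasis eroot ss) => i.
have [->|/(weight_root ebasis eroot)/root_combination[c ->]] := eqVneq (w i) 0.
  by rewrite zero_lfunE.
rewrite sum_lfunE big1 // => j _.
have -> : b j *~ c j = (c j)%:~R *: b j by rewrite scaler_int.
by rewrite scale_lfunE linearB /= hk subrr scaler0.
Qed.

(** The values on the simple roots may be prescribed as conjugates; integer coefficients carry this
    over to every weight. *)
Lemma weight_conj h : exists h', forall i, (w i h' : C) = (w i h : C)^*.
Proof.
case: base_b => _ bfree _.
have [h' h'E] := free_functionals_onto (fun j => (b j h : C)^* ) bfree.
exists h' => i.
have [->|/(weight_root ebasis eroot)/root_combination[c ->]] := eqVneq (w i) 0.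
  by rewrite !zero_lfunE conjC0.
rewrite !sum_lfunE rmorph_sum; apply: eq_bigr => j _ /=.
have -> : b j *~ c j = (c j)%:~R *: b j by rewrite scaler_int.
by rewrite !scale_lfunE h'E [in RHS]rmorphM /= rmorph_int.
Qed.

(* All roots are real on the span of the h with integral values on the simple
   roots, so the Killing form pairs h with its conjugate to a sum of squared
   moduli. *)
Lemma killing_t_nondegenerate h :
  (forall k, kappa (vsval h) (vsval k) = 0) -> h = 0.
Proof.
move=> hk; have [h' h'E] := weight_conj h.
apply: (cartan_weights_inj ebasis eroot ss) => i; apply/eqP.
have := hk h'; rewrite (killing_t ebasis eroot) => /eqP.
rewrite psumr_eq0 => [|j _]; last by rewrite h'E -normCK exprn_ge0.
by move=> /allP/(_ i (mem_index_enum _)); rewrite h'E -normCK expf_eq0 normr_eq0.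
Qed.

Lemma iter_lie_sum x m v :
  iter m (lie x) v = \sum_i coord e i v *: iter m (lie x) e`_i.
Proof.
by rewrite {1}(coord_expand ebasis v) iter_linear_comb.
Qed.

Lemma in_root_space_iter a c x y n : in_root_space a x -> in_root_space c y ->
  in_root_space (c + a *+ n) (iter n (lie x) y).
Proof.
move=> ax cy; elim: n => [|n IH]; first by rewrite addr0.
by rewrite mulrS addrCA; apply: in_root_space_lie.
Qed.

Lemma iter_eq0 x y m n : iter m (lie x) y = 0 -> (m <= n)%N -> iter n (lie x) y = 0.
Proof.
move=> xm /subnK <-; rewrite iterD xm; elim: (n - m)%N => //= k ->.
exact: linear0.
Qed.

Lemma root_vector_nilpotent a x v : a != 0 -> in_root_space a x ->
  exists n, iter n (lie x) v = 0.
Proof.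
move=> a0 ax; exists (\dim {:g}); rewrite iter_lie_sum big1 // => i _.
apply/eqP; rewrite scaler_eq0; apply/orP; right; apply: contraTT isT => xi.
(* If the last iterate were nonzero, these would be [\dim {:g} + 1] distinct weights, one more than
   there are indices for [w]. *)
pose s := [seq w i + a *+ n | n <- iota 0 (\dim {:g}).+1].
have : (size s <= size (codom w))%N.
  apply: uniq_leq_size.
    rewrite map_inj_uniq ?iota_uniq // => m n /addrI/eqP.
    rewrite -!scaler_nat -subr_eq0 -scalerBl scaler_eq0 (negPf a0) orbF subr_eq0.
    by rewrite eqr_nat => /eqP.
  move=> _ /mapP[n n_le ->]; rewrite mem_iota add0n ltnS in n_le.
  have xn : iter n (lie x) e`_i != 0.
    by apply: contraNN xi => /eqP xn; rewrite (iter_eq0 xn).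
  have /(in_root_spaceP ebasis eroot) H := in_root_space_iter n ax (eroot i).
  have [j xj] : exists j, coord e j (iter n (lie x) e`_i) != 0.
    apply/existsP; rewrite -negb_forall; apply: contraNN xn => /forallP x0.
    by apply/eqP/(basis_ext ebasis) => j; rewrite linear0; apply/eqP.
  by rewrite -(H _ xj) codom_f.
by rewrite size_map size_iota size_codom card_ord ltnn.
Qed.

Definition weight_part a x := \sum_(i | w i == a) coord e i x *: e`_i.

Lemma weight_part_in a x : in_root_space a (weight_part a x).
Proof.
move=> h; rewrite linear_sum /= scaler_sumr; apply: eq_bigr => i /eqP wi.
by apply: in_root_spaceZ; rewrite -wi.
Qed.

Lemma sum_weight_part x : x = \sum_(a <- undup (codom w)) weight_part a x.
Proof.
rewrite {1}(coord_expand ebasis x) (exchange_big_dep predT) //=.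
apply: eq_bigr => i _; rewrite big_mkcond (bigD1_seq (w i)) ?undup_uniq //=.
  by rewrite eqxx big1 ?addr0 // => a; rewrite eq_sym => /negPf ->.
by rewrite mem_undup codom_f.
Qed.

(** [linfun] takes a bare function here; its linearity is supplied in [killing_radicalP]. *)
Definition killing_radical : {vspace g} :=
  lker (linfun (fun x => \row_(i < \dim {:g}) kappa x e`_i)).

Lemma killing_radicalP x : x \in killing_radical <-> forall y, kappa x y = 0.
Proof.
have lin : linear (fun x => \row_(i < \dim {:g}) kappa x e`_i).
  move=> c y z; apply/rowP => i; rewrite !mxE !(killingC ebasis _ e`_i).
  by rewrite linearP.
pose f : {linear g -> 'rV_(\dim {:g})} :=
  HB.pack (fun x => \row_(i < \dim {:g}) kappa x e`_i)
   (GRing.isSemilinear.Build _ _ _ _ _ (GRing.semilinear_linear lin)).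
rewrite memv_ker (lfunE f); split=> [/eqP/rowP x0 y|x0]; last first.
  by apply/eqP/rowP => i; rewrite !mxE.
by apply: (killing_basis_eq0 ebasis) => i; have := x0 i; rewrite !mxE.
Qed.

Lemma killing_radical_ideal : is_ideal killing_radical.
Proof.
move=> x y /killing_radicalP ry; apply/killing_radicalP => z.
rewrite (lieC x) (killingC ebasis) linearN /= (killingC ebasis).
by rewrite killing_inv // ry oppr0.
Qed.

Lemma killing_radical_t x : x \in killing_radical -> x \in t -> x = 0.
Proof.
move=> /killing_radicalP rx xt; rewrite -(vsprojK xt).
by rewrite (@killing_t_nondegenerate (vsproj t x)) ?linear0 // => k; rewrite vsprojK.
Qed.

(** Pairing with a basis vector of weight [w j] sees only the component of weight [- w j], so it
    gives the same value on that component as on [x], and 0 on the others. *)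
Lemma weight_part_radical a x :
  x \in killing_radical -> weight_part a x \in killing_radical.
Proof.
move=> /killing_radicalP rx; apply/killing_radicalP => y.
move: y; apply: (killing_basis_eq0 ebasis) => j.
have [ej|] := eqVneq (a + w j) 0; last first.
  exact: (killing_root_spaces ebasis (@weight_part_in a x) (eroot j)).
rewrite -[RHS](rx e`_j) ![kappa _ e`_j]killingC // {2}(coord_expand ebasis x).
rewrite !linear_sum /= [RHS](bigID (fun i => w i == a)) /= [X in _ = _ + X]big1 ?addr0 //.
move=> i wi; rewrite linearZ /=.
rewrite (killing_root_spaces ebasis (eroot j) (eroot i)) ?scaler0 //.
apply: contraNneq wi => /eqP; rewrite addrC addr_eq0 => /eqP ->.
by rewrite eq_sym -addr_eq0 ej.
Qed.

(* The radical meets t trivially, hence is spanned by root vectors, and Engel's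
   theorem gives it a nonzero center, an abelian ideal of g. *)
Lemma killing_radical_eq0 : killing_radical = 0%VS.
Proof.
set I := killing_radical.
pose S x := x \in I /\ exists2 a : dual t, a != 0 & in_root_space a x.
have Slie x y : S x -> S y -> S (lie x y).
  move=> [Ix [a a0 ax]] [Iy [c c0 cy]]; split; first exact: killing_radical_ideal.
  have [ac|ac] := eqVneq (a + c) 0; last first.
    by exists (a + c) => //; apply: in_root_space_lie.
  (* A bracket of opposite weights lies in [t] and in the radical, so it is 0, which belongs to
     every weight space. *)
  exists a => //; rewrite (@killing_radical_t (lie x y)); first exact: in_root_space0.
    exact: killing_radical_ideal.
  by apply/(cartan_weight0 _ cartan_t); rewrite -ac; apply: in_root_space_lie.
have Snil x v : S x -> exists n, iter n (lie x) v = 0.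
  by move=> [_ [a a0 ax]]; apply: root_vector_nilpotent ax.
have [s [Es sS] Sspan] := engel Slie Snil.
have Ispan x : x \in I -> x \in <<s>>%VS.
  move=> Ix; rewrite (sum_weight_part x); apply: rpred_sum => a _.
  have [a0|a0] := eqVneq a 0; last first.
    apply: Sspan; split; first exact: weight_part_radical.
    by exists a => //; apply: weight_part_in.
  rewrite (@killing_radical_t (weight_part a x)) ?mem0v ?weight_part_radical //.
  by apply/(cartan_weight0 _ cartan_t); rewrite -{1}a0; apply: weight_part_in.
pose Z := (I :&: \bigcap_(i < \dim I) lker (linfun (lie (vbasis I)`_i)))%VS.
have ZP x : x \in Z <-> x \in I /\ forall y, y \in I -> lie y x = 0.
  split=> [|[Ix cx]].
    rewrite memv_cap => /andP[Ix /subv_bigcapP cx]; split=> // y Iy.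
    rewrite (coord_vbasis Iy) lie_suml big1 // => i _; rewrite lieZl.
    have := cx i isT; rewrite -memvE memv_ker lfunE /= => /eqP ->.
    by rewrite scaler0.
  rewrite memv_cap Ix /=; apply/subv_bigcapP => i _; rewrite -memvE memv_ker lfunE /=.
  by rewrite cx // vbasis_mem // mem_nth // size_tuple.
have Z0 : Z = 0%VS.
  apply: abelian_ideal_eq0 => // [x y|x y] /ZP[Ix cx].
    apply/ZP; split; first exact: killing_radical_ideal.
    move=> z Iz; rewrite lie_lie (cx z) // linear0 addr0 cx // lieC rpredN.
    exact: killing_radical_ideal.
  by move=> /ZP[Iy cy]; apply: cy.
apply/eqP; apply: contraT => I0.
(* With [W] zero, the property yields a nonzero vector of [I] killed by [s], hence by all of [I]. *)
have [||| v [Iv v0 sv]] := Es (fun x => x \in I) 0%VS.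
- by move=> a v _; apply: killing_radical_ideal.
- by move=> a v _; rewrite !memv0 => /eqP->; rewrite linear0.
- exists (vpick I); first exact: memv_pick.
  by rewrite memv0 vpick0.
rewrite -Z0 in v0; case/negP: v0; apply/ZP; split=> // y /Ispan ys.
apply/eqP; rewrite -memv0 lieC rpredN; apply: lie_span_in ys => a as_.
by rewrite lieC rpredN sv.
Qed.

Lemma killing_nondegenerate x : (forall y, kappa x y = 0) -> x = 0.
Proof. by move/killing_radicalP; rewrite killing_radical_eq0 memv0 => /eqP. Qed.

(** Some basis vector pairs nontrivially with [x], and orthogonality of the weight spaces forces its
    weight to be [- a]. *)
Lemma root_pair a x : in_root_space a x -> x != 0 ->
  exists2 y, in_root_space (- a) y & kappa x y != 0.
Proof.
move=> ax x0; have [i xi] : exists i : 'I_(\dim {:g}), kappa x e`_i != 0.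
  apply/existsP; rewrite -negb_forall; apply: contraNN x0 => /forallP xe.
  by apply/eqP/killing_nondegenerate/(killing_basis_eq0 ebasis) => i; apply/eqP.
exists e`_i => //; suff -> : - a = w i by [].
apply/eqP; rewrite eq_sym -addr_eq0 addrC; apply: contraNT xi => awi.
by rewrite (killing_root_spaces ebasis ax (eroot i)).
Qed.

Lemma is_rootN a : is_root a -> is_root (- a).
Proof.
move=> [a0 [x x0 ax]]; split; first by rewrite oppr_eq0.
have [y ay xy] := root_pair ax x0; exists y => //.
by apply: contraNneq xy => ->; rewrite killing0r.
Qed.

Lemma lie_opp_roots a x y : in_root_space a x -> in_root_space (- a) y -> lie x y \in t.
Proof.
move=> ax ay; apply/(cartan_weight0 _ cartan_t).
by rewrite -(subrr a); apply: in_root_space_lie.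
Qed.

(** The bracket of a dual pair of root vectors represents [a] up to a nonzero factor; it only has to
    be rescaled. *)
Lemma coroot_exists a : is_root a -> exists h, is_coroot a h.
Proof.
move=> ra; have [j aE] := root_weight ebasis eroot ra.
have [a0 [x x0 ax]] := ra; have [y ay xy] := root_pair ax x0.
pose h := vsproj t (lie x y); have hE : vsval h = lie x y.
  by rewrite vsprojK // (lie_opp_roots ax ay).
have kh k : kappa (vsval k) (vsval h) = (a k : C) * kappa x y.
  by rewrite hE (killing_lie_root ebasis _ _ ax).
(* If [a h = 0], pairing [h] with its conjugate shows that the squared moduli of all [w i h] sum to
   0; then [h = 0], and so [a = 0]. *)
have ah : (a h : C) != 0.
  apply: contra_neq a0 => ah; suff h0 : h = 0.
    apply/lfunP => k; rewrite zero_lfunE; apply: (mulIf xy).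
    by rewrite mul0r -kh h0 [vsval 0]linear0 killing0r.
  apply: (cartan_weights_inj ebasis eroot ss) => i; apply/eqP.
  have [h' h'E] := weight_conj h.
  have : kappa (vsval h') (vsval h) == 0 by rewrite kh -aE h'E aE ah conjC0 mul0r.
  rewrite (killing_t ebasis eroot) psumr_eq0 => [|l _]; last first.
    by rewrite h'E mulrC -normCK exprn_ge0.
  by move=> /allP/(_ i (mem_index_enum _)); rewrite h'E mulrC -normCK expf_eq0 normr_eq0.
exists ((2 / (a h : C)) *: h); split; first by rewrite linearZ /= [_ *: _]divfK.
exists ((2 / (a h : C)) *: x), y; split => //; first exact: in_root_spaceZ.
by rewrite linearZ /= hE lieZl.
Qed.

(** The factor is [kappa x y] for the triple; were it 0, [h] would be orthogonal to [t], hence 0,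
    against [a h = 2]. *)
Lemma coroot_killing a h : is_coroot a h ->
  exists2 c : C, c != 0 & forall k, kappa (vsval k) (vsval h) = (a k : C) * c.
Proof.
move=> [ah [x [y [ax ay hE]]]]; exists (kappa x y); last first.
  by move=> k; rewrite hE (killing_lie_root ebasis _ _ ax).
apply: contra_eqN ah => /eqP xy; suff -> : h = 0 by rewrite linear0 eq_sym pnatr_eq0.
apply: killing_t_nondegenerate => k; rewrite killingC // hE.
by rewrite (killing_lie_root ebasis _ _ ax) // xy mulr0.
Qed.

(** Computing [kappa] of [h] and [k] in both orders equates their two factors. Cartan integers
    thereby become single-valued. *)
Lemma coroot_unique a h k : is_coroot a h -> is_coroot a k -> h = k.
Proof.
move=> ah ak; have [c c0 ch] := coroot_killing ah; have [d d0 dk] := coroot_killing ak.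
have cd : c = d.
  apply: (@mulfI _ 2); first by rewrite pnatr_eq0.
  have [<- _] := ah; have := dk h; rewrite killingC // ch.
  by case: ah ak => -> _ [-> _].
apply/eqP; rewrite -subr_eq0; apply/eqP; apply: killing_t_nondegenerate => l.
by rewrite killingC // !linearB /= ch dk cd subrr.
Qed.

(* The Killing form identifies v with an element of t on which all roots alpha i
   vanish. *)
Lemma coroots_separate n (alpha : 'I_n -> dual t) (H : 'I_n -> subvs_of t)
    (c : 'I_n -> C) :
  (forall i, is_coroot (alpha i) (H i)) ->
  (forall h, (forall i, alpha i h = 0) -> h = 0) ->
  (forall i, \sum_k c k * (alpha k (H i) : C) = 0) ->
  \sum_k c k *: alpha k = 0.
Proof.
move=> Hcoroot alpha_inj cH.
have /fin_all_exists[d dP] : forall i, exists d : C,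
    d != 0 /\ forall k, kappa (vsval k) (vsval (H i)) = (alpha i k : C) * d.
  by move=> i; have [d d0 dP] := coroot_killing (Hcoroot i); exists d.
(* Dividing by [d k] cancels the factor of each coroot, so that [u] represents
   [\sum_k c k *: alpha k]. *)
pose u := \sum_k (c k / d k) *: H k.
have uE h : kappa (vsval h) (vsval u) = \sum_k c k * (alpha k h : C).
  rewrite !linear_sum; apply: eq_bigr => k _; rewrite !linearZ /=.
  have [d0 ->] := dP k; rewrite [LHS]mulrCA [LHS]mulrC divfK //; exact: mulrC.
have u0 : u = 0.
  apply: alpha_inj => i; have [d0 dE] := dP i; apply: (mulIf d0).
  by rewrite -dE killingC // uE cH mul0r.
apply/lfunP => h; rewrite sum_lfunE zero_lfunE; have := uE h.
rewrite u0 [vsval 0]linear0 killing0r => /esym cE; rewrite -[RHS]cE.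
by apply: eq_bigr => k _; rewrite scale_lfunE.
Qed.

(* The vector f h - h commutes with every root vector, so it is in the radical of
   the Killing form. *)
Lemma automorphism_fix_t (f : 'End(g)) (z : 'I_(\dim {:g}) -> C) h :
  is_lie_automorphism f -> (forall i, w i != 0 -> f e`_i = z i *: e`_i) ->
  f (vsval h) = vsval h.
Proof.
move=> [/eqP kerf flie] fe; apply/eqP; rewrite -subr_eq0; apply/eqP.
set u := _ - _.
have z0 i : w i != 0 -> z i != 0.
  move=> wi; have : f e`_i != 0 by rewrite -memv_ker (eqP kerf) memv0 (basis_neq0 ebasis).
  by rewrite fe //; apply: contraNneq => ->; rewrite scale0r.
have ue i : w i != 0 -> lie u e`_i = 0.
  move=> wi; rewrite lieDl lieNl eroot; apply/eqP; rewrite subr_eq0; apply/eqP.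
  apply: (scalerI (z0 i wi)); rewrite -linearZ -fe //= -flie eroot linearZ /= fe //.
  by rewrite !scalerA mulrC.
apply: killing_nondegenerate; apply: (killing_basis_eq0 ebasis) => i.
(* For a nonzero weight, invariance moves the bracket onto [u]. For weight 0, the [i]-th basis
   vector lies in [t] and scales each basis vector; [u] kills those of nonzero weight, and the
   scalar is 0 on the others. *)
have [wi|wi] := eqVneq (w i) 0; last first.
  have /lfunPn[k] := wi; rewrite zero_lfunE => wik; apply: (mulfI wik).
  rewrite mulr0 -killingZr -(eroot i k) (lieC (vsval k)) linearN /= -killing_inv //.
  by rewrite ue // killingC // killing0r oppr0.
have /(cartan_weight0 _ cartan_t) eit : in_root_space (0 : dual t) e`_i by rewrite -wi.
rewrite /killing big1 // => j _; rewrite -(vsprojK eit) eroot linearZ linearZ /=.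
have [wj|wj] := eqVneq (w j) 0; first by rewrite wj zero_lfunE mul0r.
by rewrite ue // linear0 mulr0.
Qed.

End Roots.

(** * Gradings *)

Section EigenspaceGrading.
Variables (K : fieldType) (V : lieAlgType K) (e : (\dim {:V}).-tuple V).
Hypothesis ebasis : basis_of {:V} e.

Lemma mem_leigenspace (f : 'End(V)) (a : K) x :
  (x \in passmx.leigenspace f a) = (f x == a *: x).
Proof. by rewrite (sameP eqlfunP eqP) scale_lfunE id_lfunE. Qed.

Lemma leigenspace_coordP (f : 'End(V)) (z : 'I_(\dim {:V}) -> K) a x :
  (forall i : 'I_(\dim {:V}), f e`_i = z i *: e`_i) ->
  (x \in passmx.leigenspace f a <-> forall i, coord e i x != 0 -> z i = a).
Proof.
move=> fe; rewrite mem_leigenspace; have efree := basis_free ebasis.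
have xE := coord_basis ebasis (memvf x).
have fxE : f x = \sum_i (coord e i x * z i) *: e`_i.
  by rewrite {1}xE linear_sum; apply: eq_bigr => i _; rewrite linearZ /= fe scalerA.
split=> [/eqP fx i xi|H].
  apply: (mulfI xi); rewrite -[LHS](coord_sum_free (fun i => coord e i x * z i) i efree).
  by rewrite -fxE fx linearZ mulrC.
rewrite fxE [in X in _ == X]xE scaler_sumr; apply/eqP/eq_bigr => i _.
rewrite scalerA; have [->|/H ->] := eqVneq (coord e i x) 0; last by rewrite mulrC.
by rewrite mulr0 mul0r.
Qed.

Variables (G : int -> {vspace V}) (D : 'I_(\dim {:V}) -> int).
Hypothesis GP : forall j x, x \in G j <-> forall i, coord e i x != 0 -> D i = j.

(** By [GP] each [G j] is spanned by the basis vectors of degree [j], so sums of pieces are read off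
    from supports. *)
Lemma sum_degreesP (s : seq int) x :
  x \in (\sum_(j <- s) G j)%VS <-> forall i, coord e i x != 0 -> D i \in s.
Proof.
split=> [|H].
  elim: s x => [|j s IH] x.
    by rewrite big_nil memv0 => /eqP -> i; rewrite linear0 eqxx.
  rewrite big_cons => /memv_addP[u /GP uj [v /IH vs ->]] i.
  rewrite linearD /= inE.
  have [->|/uj ->] := eqVneq (coord e i u) 0; last by rewrite eqxx.
  by rewrite add0r => /vs ->; rewrite orbT.
rewrite (coord_basis ebasis (memvf x)); apply: rpred_sum => i _.
have [->|/H Ds] := eqVneq (coord e i x) 0; first by rewrite scale0r mem0v.
rewrite (big_rem _ Ds) /=; apply: memvZ; apply: (subvP (addvSl _ _)).
apply/GP => k; rewrite coord_free ?(basis_free ebasis) //.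
by have [->//|_] := eqVneq i k; rewrite eqxx.
Qed.

Lemma degrees_direct_sum (P : pred int) (U : {vspace V}) :
  (forall x, x \in U <-> forall i, coord e i x != 0 -> P (D i)) ->
  direct_sum_over P G U.
Proof.
move=> UP; split=> [s s_uniq _|x].
  rewrite directvE /=; elim: s s_uniq => [|j s IH] /=; first by rewrite !big_nil dimv0.
  move=> /andP[js /IH /eqP dims]; rewrite !big_cons dimv_disjoint_sum ?dims //.
  apply/eqP; rewrite -subv0; apply/subvP => x.
  rewrite memv_cap => /andP[/GP xj /sum_degreesP xs].
  rewrite memv0 (coord_basis ebasis (memvf x)) big1 // => i _.
  have [->|xi] := eqVneq (coord e i x) 0; first by rewrite scale0r.
  by case/negP: js; rewrite -(xj i xi); apply: xs.
split=> [/UP xP|[s /allP sP /sum_degreesP xs]]; last by apply/UP => i /xs /sP.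
(* The degrees occurring in [x]; repetitions are harmless in a sum of subspaces. *)
exists [seq D i | i <- enum 'I_(\dim {:V}) & coord e i x != 0].
  by apply/allP => _ /mapP[i + ->]; rewrite mem_filter => /andP[/xP].
by apply/sum_degreesP => i xi; apply: map_f; rewrite mem_filter xi mem_enum.
Qed.

End EigenspaceGrading.

(** * Marks and root coordinates on the affine diagram *)

Section AffineSystem.
Variables (C : numClosedFieldType) (g : lieAlgType C) (t : {vspace g}).
Variables (r : nat) (alpha : 'I_r.+1 -> dual t) (n : 'I_r.+1 -> nat).
Hypothesis ss : is_semisimple g.
Hypothesis cartan_t : is_cartan t.
Hypothesis affine : affine_system alpha n.

Let base_alpha : is_base (fun k : 'I_r => alpha (lift ord0 k)).
Proof. by case: affine. Qed.

Lemma affine_relation : \sum_k alpha k *+ n k = 0.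
Proof.
by case: affine => _ _ alpha0 n0; rewrite big_ord_recl n0 alpha0 mulr1n addNr.
Qed.

(** Eliminating [alpha ord0] leaves a relation among the independent simple roots. *)
Lemma affine_relation_unique (c : 'I_r.+1 -> C) :
  \sum_k c k *: alpha k = 0 -> forall k, c k = c ord0 * (n k)%:R.
Proof.
case: affine => -[_ /free_familyP bfree _] _ alpha0 n0 c0.
have /bfree H : \sum_(k < r)
    (c (lift ord0 k) - c ord0 * (n (lift ord0 k))%:R) *: alpha (lift ord0 k) = 0.
  rewrite -[RHS]c0 big_ord_recl alpha0 scalerN scaler_sumr addrC -sumrB.
  by apply: eq_bigr => k _; rewrite scalerBl -scalerA scaler_nat.
move=> k; have [k' ->|->] := unliftP ord0 k; last by rewrite n0 mulr1.
by apply/eqP; rewrite -subr_eq0 H.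
Qed.

Lemma affine_root k : is_root (alpha k).
Proof.
have [e [w [ebasis eroot]]] := weight_basis cartan_t.
case: affine => -[broot _ _] [droot _] alpha0 _.
have [k' ->|->] := unliftP ord0 k; first exact: broot.
by rewrite alpha0; apply: (is_rootN ebasis eroot ss cartan_t base_alpha).
Qed.

Lemma affine_ext (h : subvs_of t) : (forall k, alpha k h = 0) -> h = 0.
Proof.
have [e [w [ebasis eroot]]] := weight_basis cartan_t.
move=> h0; apply: (base_ext ebasis eroot ss base_alpha) => k.
by rewrite h0 linear0.
Qed.

(* A diagram automorphism permutes the coroots of the vertices, so the permuted
   marks satisfy the linear relation that determines the marks up to a scalar. *)
Lemma diagram_automorphism_marks (s : {perm 'I_r.+1}) :
  diagram_automorphism alpha s -> forall k, n (s k) = n k.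
Proof.
have [e [w [ebasis eroot]]] := weight_basis cartan_t.
move=> sauto.
have /fin_all_exists[H HP] : forall i, exists h, is_coroot (alpha i) h.
  move=> i; apply: (coroot_exists ebasis eroot ss cartan_t base_alpha).
  exact: affine_root.
(* Uniqueness of coroots turns the preserved relation [is_cartan_integer] into an equation between
   values at the chosen [H]. *)
have Hs i j : (alpha (s i) (H (s j)) : C) = alpha i (H j).
  have [h hj <-] : is_cartan_integer (alpha i) (alpha j) (alpha (s i) (H (s j))).
    by apply/sauto; exists (H (s j)).
  by rewrite (coroot_unique ebasis eroot ss base_alpha hj (HP j)).
have n0 : n ord0 = 1%N by case: affine.
have nsE k : (n (s k))%:R = (n (s ord0))%:R * (n k)%:R :> C.
  apply: (affine_relation_unique (c := fun k => (n (s k))%:R)) k.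
  apply: (coroots_separate ebasis eroot ss base_alpha HP affine_ext) => i.
  (* The relation among the marks, evaluated at [H (s i)] and reindexed by [s]. *)
  have /lfunP/(_ (H (s i))) := affine_relation.
  rewrite sum_lfunE zero_lfunE (reindex_inj (@perm_inj _ s)) /= => rel.
  rewrite -[RHS]rel; apply: eq_bigr => k _.
  by rewrite -scaler_nat scale_lfunE Hs.
(* A permutation preserves the positive sum of all marks, so the proportionality factor is 1. *)
have ns0 : n (s ord0) = 1%N.
  have : (\sum_k n (s k) = n (s ord0) * \sum_k n k)%N.
    rewrite big_distrr /=; apply: eq_bigr => k _.
    by apply/eqP; rewrite -(eqr_nat C) nsE natrM.
  have -> : (\sum_k n (s k) = \sum_k n k)%N by rewrite [RHS](reindex_inj (@perm_inj _ s)).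
  move=> sumE; apply/eqP.
  have sum_gt0 : (0 < \sum_k n k)%N by rewrite (bigD1 ord0) //= n0.
  by rewrite -(eqn_pmul2r sum_gt0) -sumE mul1n.
by move=> k; apply/eqP; rewrite -(eqr_nat C) nsE ns0 mul1r.
Qed.

(** The highest root bounds the coefficients of a positive root, which gets 0 at [ord0]. A negative
    root with coefficients [- c k] is [alpha ord0] plus the combination with coefficients
    [n (lift ord0 k) - c k]. *)
Lemma root_coordinates a : is_root a -> exists c : 'I_r.+1 -> nat,
  (forall k, (c k <= n k)%N) /\ a = \sum_k alpha k *+ c k.
Proof.
have [e [w [ebasis eroot]]] := weight_basis cartan_t.
case: (affine) => -[_ /free_familyP bfree base] [_ dom] alpha0 n0.
have pos (c : 'I_r -> nat) : is_root (\sum_k alpha (lift ord0 k) *+ c k) ->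
    forall k, (c k <= n (lift ord0 k))%N.
  move=> /dom[d dE]; have /bfree H : \sum_(k < r)
      ((n (lift ord0 k))%:R - (c k)%:R - (d k)%:R) *: alpha (lift ord0 k) = 0.
    apply/eqP; under eq_bigr => k _ do rewrite !scalerBl !scaler_nat.
    by rewrite !sumrB -dE subrr.
  move=> k; rewrite -(ler_nat C) -subr_ge0; have /eqP := H k.
  by rewrite subr_eq0 => /eqP ->; apply: ler0n.
move=> ra; have [c [] aE] := base a ra.
  exists (fun k => oapp c 0%N (unlift ord0 k)); split=> [k|].
    have [k' ->|->] := unliftP ord0 k; last by [].
    by apply: pos; rewrite -aE.
  rewrite big_ord_recl unlift_none /= add0r aE.
  by apply: eq_bigr => k _; rewrite liftK.
have rNa := is_rootN ebasis eroot ss cartan_t base_alpha ra.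
have cn : forall k, (c k <= n (lift ord0 k))%N.
  by apply: pos; rewrite -[X in is_root X]opprK -aE.
exists (fun k => oapp (fun k => n (lift ord0 k) - c k)%N 1%N (unlift ord0 k)).
split=> [k|].
  have [k' ->|->] := unliftP ord0 k; first exact: leq_subr.
  by rewrite /= n0.
rewrite big_ord_recl unlift_none /= alpha0 aE -sumrN.
rewrite -[- _ *+ 1]/(- _) -sumrN -big_split; apply: eq_bigr => k _.
by rewrite liftK /= mulrnBr // addrA addNr add0r.
Qed.

(* p k is lowered by m at the vertex j of mark 1, which turns the relation
   sum_k n k p k = m into compatibility with sum_k n k alpha k = 0. *)
Lemma root_degrees (m : nat) (p : 'I_r.+1 -> nat) (j : 'I_r.+1) :
  (\sum_k n k * p k = m)%N -> n j = 1%N -> (0 < p j)%N ->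
  exists h : subvs_of t, forall a, is_root a ->
    exists (c : 'I_r.+1 -> nat) (d : int), [/\ forall k, (c k <= n k)%N,
      a = \sum_k alpha k *+ c k, (a h : C) = d%:~R,
      `|d| < m%:Z & (d == (\sum_k c k * p k)%N %[mod m])%Z].
Proof.
move=> sum_p nj pj; pose q k : int := (p k)%:Z - (k == j)%:Z * m%:Z.
have sum_q (c : 'I_r.+1 -> nat) :
    \sum_k (c k)%:Z * q k = (\sum_k c k * p k)%N%:Z - (c j)%:Z * m%:Z.
  rewrite /q /=; under eq_bigr => k _ do rewrite mulrBr.
  rewrite sumrB (big_morph Posz PoszD (erefl _)); congr (_ - _).
  rewrite (bigD1 j) //= eqxx mul1r big1 ?addr0 // => k /negPf ->.
  by rewrite mul0r mulr0.
have bfree : free [seq alpha (lift ord0 k) | k : 'I_r] by case: base_alpha.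
have [h hE] := free_functionals_onto (fun k => (q (lift ord0 k))%:~R) bfree.
(* Only the values on the simple roots are free; the one at [ord0] is forced by the relation, and is
   [q ord0] because [\sum_k n k * q k = 0]. *)
have alphah k : (alpha k h : C) = (q k)%:~R.
  have [k' ->|->] := unliftP ord0 k; first exact: hE.
  have n0 : n ord0 = 1%N by case: affine.
  have := affine_relation; rewrite big_ord_recl n0 => /lfunP/(_ h); rewrite zero_lfunE.
  have := sum_q n; rewrite sum_p nj mul1r subrr big_ord_recl n0 mul1r.
  move=> /(congr1 (fun x : int => x%:~R : C)).
  rewrite rmorphD rmorph_sum /= rmorph0 => <-.
  rewrite add_lfunE sum_lfunE; set S := \sum_i _; set S' := \sum_i _.
  suff -> : S = S' by move/addIr.
  apply: eq_bigr => k' _; rewrite -scaler_nat scale_lfunE hE rmorphM /=.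
  by rewrite -pmulrn.
exists h => a ra; have [c [cn aE]] := root_coordinates ra.
exists c, (\sum_k (c k)%:Z * q k); split=> //.
- rewrite aE sum_lfunE rmorph_sum; apply: eq_bigr => k _.
  by rewrite -scaler_nat scale_lfunE alphah rmorphM /= -pmulrn.
(* Raising the coordinate at [j] to its mark keeps the sum at most [m]. So the sum is at most
   [m - p j] if [c j = 0]; if [c j = 1], it lies between [p j] and [m] before [m] is subtracted. *)
- have cp : (\sum_k c k * p k + (n j - c j) * p j <= m)%N.
    rewrite -sum_p (bigD1 j) //= [X in (_ <= X)%N](bigD1 j) //= addnAC -mulnDl.
    rewrite subnKC // leq_add2l leq_sum // => k _; exact: leq_mul.
  have cp' : (c j * p j <= \sum_k c k * p k)%N by rewrite (bigD1 j) //= leq_addr.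
  rewrite sum_q; have := cn j; rewrite nj in cp *.
  case: (c j) cp cp' => [|[|//]] cp cp' _.
    rewrite mul0r subr0 ger0_norm // ltz_nat; apply: leq_trans cp.
    by rewrite subn0 mul1n -addn1 leq_add2l.
  rewrite mul1r ltr_norml mul1n in cp' *.
  rewrite subnn mul0n addn0 in cp; apply/andP; split.
    by rewrite ltrBrDr addNr ltz_nat (leq_trans pj).
  rewrite ltrBlDr -PoszD ltz_nat (leq_ltn_trans cp) //.
  by rewrite -[X in (X < _)%N]add0n ltn_add2r (leq_trans pj (leq_trans cp' cp)).
- by rewrite sum_q eqz_mod_dvd addrAC subrr add0r rpredN dvdz_mull.
Qed.

End AffineSystem.

Section RootsOfUnity.

Lemma exprz_modz (F : fieldType) (m : nat) (z : F) (j : int) :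
  (0 < m)%N -> z ^+ m = 1 -> z ^ j = z ^+ absz (j %% m)%Z.
Proof.
move=> m_gt0 zm; have m0 : m%:Z != 0 by rewrite eqz_nat -lt0n.
have z0 : z != 0.
  apply/eqP => z0; move/eqP: zm.
  by rewrite z0 expr0n eqn0Ngt m_gt0 eq_sym oner_eq0.
rewrite {1}(divz_eq j m) expfzDr // [(_ * m%:Z)]mulrC -exprz_exp.
by rewrite -exprnP zm exp1rz mul1r exprnP gez0_abs // modz_ge0.
Qed.

Lemma eq_prim_root_exprz (F : fieldType) (m : nat) (z : F) (j k : int) :
  m.-primitive_root z -> (z ^ j == z ^ k) = (j == k %[mod m])%Z.
Proof.
move=> zprim; have m_gt0 := prim_order_gt0 zprim.
have m0 : m%:Z != 0 by rewrite eqz_nat -lt0n.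
rewrite !(exprz_modz _ m_gt0 (prim_expr_order zprim)) (eq_prim_root_expr zprim).
have lt l : (absz (l %% m)%Z < m)%N by rewrite -ltz_nat gez0_abs ?modz_ge0 // ltz_pmod.
by rewrite !modn_small // -eqz_nat !gez0_abs ?modz_ge0.
Qed.

Local Open Scope complex_scope.

(** De Moivre's formula turns the power into the angle [pi *+ 2]. *)
Lemma zeta_expn (R : realType) (m : nat) : (0 < m)%N -> zeta R m ^+ m = 1.
Proof.
move=> m0; rewrite /zeta; set x := _ / _.
have -> k : (cos x +i* sin x) ^+ k = cos (x *+ k) +i* sin (x *+ k).
  elim: k => [|k IH]; first by rewrite expr0 mulr0n cos0 sin0.
  rewrite exprS IH mulrS cosD sinD; simpc.
  by congr (_ +i* _); rewrite addrC.
have -> : x *+ m = pi *+ 2.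
  by rewrite /x -mulr_natr divfK ?pnatr_eq0 -?lt0n // mulr_natl.
by rewrite cos2pi sin2pi.
Qed.
End RootsOfUnity.

(** * The lifted grading from a common eigenbasis *)

Section Lifting.
Local Open Scope complex_scope.
Variables (R : realType) (g : lieAlgType R[i]) (theta : 'End(g)) (m : nat).
Variables (e : (\dim {:g}).-tuple g) (D : 'I_(\dim {:g}) -> int).
Hypothesis ebasis : basis_of {:g} e.
Hypothesis theta_order : has_order theta m.
Hypothesis thetaE : forall i : 'I_(\dim {:g}), theta e`_i = zeta R m ^ D i *: e`_i.

(* zeta m has order dividing m, and theta would have a smaller order if zeta m
   had. *)
Lemma zeta_prim : m.-primitive_root (zeta R m).
Proof.
case: theta_order => m_gt0 _ order.
have [d dprim dm] := prim_order_exists m_gt0 (zeta_expn R m_gt0).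
have d_gt0 := prim_order_gt0 dprim.
suff /eqP dE : d == m by rewrite -{1}dE.
rewrite eqn_leq dvdn_leq //= leqNgt; apply/negP => d_lt.
have [|x] := order d; first by rewrite d_gt0.
rewrite {1}(coord_basis ebasis (memvf x)) iter_linear_comb.
rewrite {2}(coord_basis ebasis (memvf x)); case/eqP.
apply: eq_bigr => i _; congr (_ *: _).
have iterE k : iter k theta e`_i = (zeta R m ^ D i) ^+ k *: e`_i.
  by elim: k => [|k IH]; rewrite ?scale1r // iterS IH linearZ /= thetaE scalerA exprSr.
rewrite iterE exprnP exprz_exp mulrC -exprz_exp -exprnP (prim_expr_order dprim).
by rewrite exp1rz scale1r.
Qed.

(** The [D i] are both the eigenvalues of [lie h] and the exponents of [theta] on one basis, so the
    two gradings group the same vectors, by degree and by degree modulo [m]. *)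
Lemma grading_lifts (h : g) :
  (forall i : 'I_(\dim {:g}), lie h e`_i = (D i)%:~R *: e`_i) ->
  (forall i, `|D i| < m%:Z) ->
  let G (j : int) := passmx.leigenspace (linfun (lie h)) j%:~R in
  [/\ is_Zgrading G, lifts_to theta m G & forall j : int, m%:Z <= `|j| -> G j = 0%VS].
Proof.
move=> hE Dm G.
have GP j x : x \in G j <-> forall i, coord e i x != 0 -> D i = j.
  rewrite (leigenspace_coordP (z := fun i => (D i)%:~R) ebasis) => [|i]; last first.
    by rewrite lfunE /= hE.
  by split=> H i /H => [/intr_inj|->].
split.
- split; first by apply: (degrees_direct_sum ebasis GP) => x; split=> // _; apply: memvf.
  move=> j k x y; rewrite !mem_leigenspace !lfunE /= => /eqP hx /eqP hy.
  by rewrite lie_lie hx hy linearZ lieZl /= -scalerDl rmorphD.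
- move=> j; apply: (degrees_direct_sum ebasis GP) => x.
  rewrite (leigenspace_coordP (z := fun i => zeta R m ^ D i) ebasis) //.
  by split=> H i /H; rewrite -(eq_prim_root_exprz _ _ zeta_prim) => /eqP.
- move=> j jm; apply/eqP; rewrite -subv0; apply/subvP => x /GP xj.
  rewrite memv0 (coord_basis ebasis (memvf x)) big1 // => i _.
  have [->|/xj Dj] := eqVneq (coord e i x) 0; first by rewrite scale0r.
  by have := Dm i; rewrite Dj ltNge jm.
Qed.
End Lifting.

Local Open Scope complex_scope.

Theorem proposition2p28 (R : realType) (g : lieAlgType R[i])
    (theta : 'End(g)) (m : nat)
    (t : {vspace g}) (r : nat) (alpha : 'I_r.+1 -> dual t)
    (n p : 'I_r.+1 -> nat) :
  is_semisimple g ->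
  inner_automorphism theta ->
  has_order theta m ->
  is_cartan t ->
  affine_system alpha n ->
  classified_by theta m alpha n p ->
  (exists (s : {perm 'I_r.+1}) (j : 'I_r.+1),
      [/\ diagram_automorphism alpha s, (0 < p j)%N & s j = ord0]) ->
  exists G : int -> {vspace g},
    [/\ is_Zgrading G,
        lifts_to theta m G &
        forall j : int, m%:Z <= `|j| -> G j = 0%VS].
Proof.
move=> ss [theta_auto _] theta_order cartan_t affine [sum_p theta_root].
move=> [s [j [sauto pj sj]]].
have nj : n j = 1%N.
  rewrite -(diagram_automorphism_marks ss cartan_t affine sauto) sj.
  by case: affine.
have [m_gt0 _ _] := theta_order.
have [h hP] := root_degrees ss cartan_t affine sum_p nj pj.
have [e [w [ebasis eroot]]] := weight_basis cartan_t.
have base_alpha : is_base (fun k : 'I_r => alpha (lift ord0 k)) by case: affine.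
(* Weight 0 takes [d = 0], where the last clause is vacuous; for a root, [d] is congruent modulo [m]
   to the exponent given by the labels. *)
have /fin_all_exists[D DP] : forall i, exists d : int,
    [/\ w i h = d%:~R, `|d| < m%:Z & w i != 0 -> theta e`_i = zeta R m ^ d *: e`_i].
  move=> i; have [wi|wi] := eqVneq (w i) 0.
    by exists 0; rewrite wi zero_lfunE.
  have ri := weight_root ebasis eroot wi.
  have [c [d [cn wE hd dm dmod]]] := hP _ ri.
  exists d; split=> // _; apply/eqP; rewrite -mem_leigenspace.
  have := theta_root _ _ ri cn wE _ (eroot i); rewrite /mod_piece.
  have zm := exprz_modz _ m_gt0 (zeta_expn R m_gt0).
  by rewrite [zeta R m ^ d]zm (eqP dmod) -zm.
(* On vectors of weight 0 the degree is 0, and [theta] fixes [t] pointwise since it scales every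
   root vector of the basis. *)
have thetaE (i : 'I_(\dim {:g})) : theta e`_i = zeta R m ^ D i *: e`_i.
  have [wh _ theta_e] := DP i; have [wi|] := eqVneq (w i) 0; last exact: theta_e.
  have D0 : D i = 0.
    by apply: (intr_inj (R := R[i])); rewrite -wh wi zero_lfunE.
  have /(cartan_weight0 _ cartan_t) eit : in_root_space (0 : dual t) e`_i.
    by rewrite -[X in in_root_space X]wi.
  rewrite D0 expr0z scale1r -(vsprojK eit).
  apply: (automorphism_fix_t ebasis eroot ss cartan_t base_alpha
            (z := fun i => zeta R m ^ D i)) => // k wk.
  by have [_ _ ->] := DP k.
eexists; apply: (grading_lifts ebasis theta_order thetaE (h := vsval h)) => i.
  by have [<- _ _] := DP i; apply: eroot.
by have [] := DP i.
Qed.
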